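(* Let $f$ be a multiplicative graph invariant and let $G=H_1\sqcup\cdots\sqcup H_k$ with $k\geq 1$ and $f(G)\neq 0$. Let $I=\{i\in\{1,\dots,k\}: es_f(H_i)<\infty\}$. Then $es_f(G)=\infty$ if $I=\emptyset$, and $es_f(G)=\min\{es_f(H_i): i\in I\}$ otherwise.
   Context: All graphs are finite and simple. An invariant is a function $f$ from graphs to $[0,\infty)$ that is constant on isomorphism classes. $\sqcup$ denotes disjoint union of graphs. $f$ is multiplicative if $f(H_1\sqcup H_2)=f(H_1)\cdot f(H_2)$ for all disjoint graphs $H_1,H_2$. The $f$-edge stability number is $es_f(G)=\min\{|Y|: Y\subseteq E(G),\ f(G-Y)\neq f(G)\}$, and $es_f(G)=\infty$ if $f(G-Y)=f(G)$ for all $Y\subseteq E(G)$. *)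

(* Defs.v *)
From HB Require Import structures.
From mathcomp Require Import all_boot all_order all_algebra.
From mathcomp Require Import reals constructive_ereal.

Set Implicit Arguments.
Unset Strict Implicit.
Unset Printing Implicit Defensive.

Import Order.TTheory GRing.Theory Num.Theory.
Local Open Scope ring_scope.

Record sgraph := SGraph {
  vertex :> finType;
  adj : rel vertex;
  adj_sym : symmetric adj;
  adj_irrefl : irreflexive adj }.

Definition edge_set (G : sgraph) : {set {set G}} :=
  [set e | [exists x : G, exists y : G, adj x y && (e == [set x; y])]].

Definition isomorphic (G H : sgraph) : Prop :=
  exists2 h : G -> H, bijective h & {mono h : x y / adj x y}.

Section EdgeDeletion.
Variables (G : sgraph) (Y : {set {set G}}).

Definition del_adj : rel G := fun x y => adj x y && ([set x; y] \notin Y).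

Fact del_adj_sym : symmetric del_adj.
Proof. by move=> x y; rewrite /del_adj adj_sym setUC. Qed.

Fact del_adj_irrefl : irreflexive del_adj.
Proof. by move=> x; rewrite /del_adj adj_irrefl. Qed.

Definition del_edges : sgraph := SGraph del_adj_sym del_adj_irrefl.
End EdgeDeletion.

Section DisjointUnion.
Variables H1 H2 : sgraph.

Definition union_adj : rel (H1 + H2)%type := fun u v =>
  match u, v with
  | inl x, inl y => adj x y
  | inr x, inr y => adj x y
  | _, _ => false
  end.

Fact union_adj_sym : symmetric union_adj.
Proof. by move=> [x|x] [y|y] //=; rewrite adj_sym. Qed.

Fact union_adj_irrefl : irreflexive union_adj.
Proof. by move=> [x|x] /=; rewrite adj_irrefl. Qed.

Definition disj_union : sgraph := SGraph union_adj_sym union_adj_irrefl.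
End DisjointUnion.

Section IndexedDisjointUnion.
Variables (k : nat) (H : 'I_k -> sgraph).

Definition big_union_adj : rel {i : 'I_k & H i} := fun u v =>
  (tag u == tag v) && adj (tagged u) (tagged_as u v).

Fact big_union_adj_sym : symmetric big_union_adj.
Proof.
move=> [i x] [j y]; rewrite /big_union_adj /= eq_sym.
by case: eqP => //= ji; case: i / ji x => x; rewrite !tagged_asE adj_sym.
Qed.

Fact big_union_adj_irrefl : irreflexive big_union_adj.
Proof. by move=> [i x]; rewrite /big_union_adj tagged_asE adj_irrefl andbF. Qed.

Definition big_disj_union : sgraph :=
  SGraph big_union_adj_sym big_union_adj_irrefl.
End IndexedDisjointUnion.

Section Invariants.
Variable R : realType.
Implicit Type f : sgraph -> R.

Definition graph_invariant f : Prop :=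
  (forall G, 0 <= f G) /\ (forall G H, isomorphic G H -> f G = f H).

Definition multiplicative_invariant f : Prop :=
  forall H1 H2, f (disj_union H1 H2) = f H1 * f H2.

Definition changing_sets f (G : sgraph) : {set {set {set G}}} :=
  [set Y : {set {set G}} | (Y \subset edge_set G) & f (del_edges Y) != f G].

(* The iterated minimum is +oo exactly when no edge set changes the value of
   f, since every cardinal is finite. *)
Definition es f (G : sgraph) : \bar R :=
  (\big[Order.min/+oo]_(Y in changing_sets f G) #|Y|%:R%:E)%E.
End Invariants.

(* Main.v *)
(* A multiplicative f is the product of its values on the components, and
   deleting edges from a disjoint union deletes edges from each component
   separately. As all factors are nonzero, changing f on one component changes
   f on the union, and changing f on the union requires changing it on some
   component, with no more edges deleted. *)
Require Import Defs.
From mathcomp Require Import all_boot all_order all_algebra.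
From mathcomp Require Import reals constructive_ereal.

Import Order.TTheory GRing.Theory Num.Theory.
Local Open Scope ring_scope.

Lemma edge_setP (G : sgraph) (e : {set G}) :
  reflect (exists x y, adj x y /\ e = [set x; y]) (e \in edge_set G).
Proof.
rewrite inE; apply: (iffP existsP) => [[x /existsP[y /andP[xy /eqP]]]|].
  by exists x, y.
by move=> [x [y [xy ->]]]; exists x; apply/existsP; exists y; rewrite xy eqxx.
Qed.

Lemma isomorphic_del0 (G : sgraph) : isomorphic (del_edges (set0 : {set {set G}})) G.
Proof.
exists id; first by exists id.
by move=> x y; rewrite /= /del_adj inE andbT.
Qed.

Section BigDisjointUnion.
Context {k : nat} {H : 'I_k -> sgraph}.
Notation G := (big_disj_union H).

Definition inj_comp (i : 'I_k) (x : H i) : G := Tagged (fun i => vertex (H i)) x.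

Lemma inj_comp_inj (i : 'I_k) : injective (@inj_comp i).
Proof. by move=> x y /eqP; rewrite eq_Tagged => /eqP. Qed.

Lemma adj_inj_comp (i : 'I_k) (x y : H i) :
  @adj G (inj_comp i x) (inj_comp i y) = adj x y.
Proof. by rewrite /= /big_union_adj /= eqxx tagged_asE. Qed.

Lemma card_big_union : #|G| = (\sum_i #|H i|)%N.
Proof. by rewrite card_tagged sumnE big_map enumT [index_enum _]unlock. Qed.

(** Preimage of [Y] under the embedding of component [i]; members of [Y] that leave this component
    are dropped. *)
Definition restr_edges (Y : {set {set G}}) (i : 'I_k) : {set {set H i}} :=
  [set e : {set H i} | inj_comp i @: e \in Y].

(** Both graphs have the same vertex type, so the identity serves: vertices with different tags are
    adjacent in neither graph, and within component [i] the pair [[set x; y]] is restricted away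
    exactly when its image lies in [Y]. *)
Lemma isomorphic_del_big_union (Y : {set {set G}}) :
  isomorphic (del_edges Y) (big_disj_union (fun i => del_edges (restr_edges Y i))).
Proof.
exists id; first by exists id.
move=> [i x] [j y]; rewrite /= /del_adj /= /big_union_adj /=.
case: eqP => //= ij; case: j / ij y => y; rewrite !tagged_asE.
by rewrite /= /del_adj inE imsetU1 imset_set1.
Qed.

Lemma restr_edges_sub (Y : {set {set G}}) (i : 'I_k) :
  Y \subset edge_set G -> restr_edges Y i \subset edge_set (H i).
Proof.
move=> /subsetP YG; apply/subsetP => e; rewrite inE => /YG/edge_setP.
move=> [u [v [uv euv]]]; apply/edge_setP.
have /imsetP[x _ ux] : u \in inj_comp i @: e by rewrite euv !inE eqxx.
have /imsetP[y _ vy] : v \in inj_comp i @: e by rewrite euv !inE eqxx orbT.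
exists x, y; split; first by rewrite -adj_inj_comp -ux -vy.
apply: (imset_inj (inj_comp_inj i)).
by rewrite euv imsetU1 imset_set1 ux vy.
Qed.

Lemma card_restr_edges (Y : {set {set G}}) (i : 'I_k) :
  (#|restr_edges Y i| <= #|Y|)%N.
Proof.
rewrite -(card_imset _ (imset_inj (inj_comp_inj i))).
by apply/subset_leq_card/subsetP => _ /imsetP[e + ->]; rewrite inE.
Qed.

Definition lift_edges (i : 'I_k) (Z : {set {set H i}}) : {set {set G}} :=
  [set inj_comp i @: e | e : {set H i} in Z].

Lemma card_lift_edges (i : 'I_k) (Z : {set {set H i}}) : #|lift_edges i Z| = #|Z|.
Proof. exact/card_imset/imset_inj/inj_comp_inj. Qed.

Lemma lift_edges_sub (i : 'I_k) (Z : {set {set H i}}) :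
  Z \subset edge_set (H i) -> lift_edges i Z \subset edge_set G.
Proof.
move=> /subsetP ZH; apply/subsetP => _ /imsetP[e /ZH/edge_setP + ->].
move=> [x [y [xy ->]]]; apply/edge_setP; exists (inj_comp i x), (inj_comp i y).
by rewrite adj_inj_comp imsetU1 imset_set1.
Qed.

Lemma lift_edgesK (i : 'I_k) (Z : {set {set H i}}) : restr_edges (lift_edges i Z) i = Z.
Proof. by apply/setP => e; rewrite inE mem_imset //; exact/imset_inj/inj_comp_inj. Qed.

(** Edges are nonempty, so each lifted one has a vertex tagged [i], which no image from component
    [j] contains. An empty set in [Z] would restrict to every component. *)
Lemma restr_lift_edges_neq (i j : 'I_k) (Z : {set {set H i}}) :
  Z \subset edge_set (H i) -> j != i -> restr_edges (lift_edges i Z) j = set0.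
Proof.
move=> /subsetP ZH ji; apply/setP => e; rewrite !inE; apply/negP.
move=> /imsetP[e' /ZH/edge_setP[x [y [_ ->]]] ee'].
have /imsetP[z _ /(congr1 tag)/= ij] : inj_comp i x \in inj_comp j @: e.
  by rewrite ee' imset_f // !inE eqxx.
by rewrite ij eqxx in ji.
Qed.
End BigDisjointUnion.

Lemma isomorphic_big_union1 (H : 'I_1 -> sgraph) :
  isomorphic (H ord0) (big_disj_union H).
Proof.
exists (@inj_comp _ H ord0); last by move=> x y; exact: adj_inj_comp.
apply: inj_card_bij; first exact: inj_comp_inj.
by rewrite card_big_union big_ord1.
Qed.

Lemma isomorphic_big_union_recl (k : nat) (H : 'I_k.+1 -> sgraph) :
  isomorphic (disj_union (H ord0) (big_disj_union (fun i => H (lift ord0 i))))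
             (big_disj_union H).
Proof.
pose h (u : (H ord0 + {i : 'I_k & H (lift ord0 i)})%type) : big_disj_union H :=
  match u with
  | inl x => inj_comp ord0 x
  | inr v => inj_comp (lift ord0 (tag v)) (tagged v)
  end.
exists h.
  (* Injectivity and a vertex count give bijectivity without an explicit inverse. *)
  apply: inj_card_bij; last first.
    by rewrite card_sum !card_big_union big_ord_recl.
  move=> [x|[i x]] [y|[j y]] //=.
  - by move=> /inj_comp_inj ->.
  - move=> e; have ij : i = j := lift_inj (congr1 tag e).
    by case: j / ij y e => y /inj_comp_inj ->.
move=> [x|[i x]] [y|[j y]] //=; first by rewrite /big_union_adj eqxx tagged_asE.
rewrite /big_union_adj /= (inj_eq lift_inj).
case: eqP => //= ij; case: j / ij y => y.
by rewrite !tagged_asE.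
Qed.

Section Multiplicative.
Variables (R : realType) (f : sgraph -> R).
Hypotheses (f_inv : graph_invariant f) (f_mul : multiplicative_invariant f).

(* For k = 0 this fails when f is identically 0. *)
Lemma multiplicative_big_union (k : nat) (H : 'I_k -> sgraph) :
  (0 < k)%N -> f (big_disj_union H) = \prod_i f (H i).
Proof.
case: f_inv => _ f_iso; case: k H => // k + _; elim: k => [|k IHk] H.
  by rewrite big_ord1 (f_iso _ _ (isomorphic_big_union1 H)).
by rewrite -(f_iso _ _ (isomorphic_big_union_recl _ H)) f_mul IHk [RHS]big_ord_recl.
Qed.

Lemma multiplicative_del_big_union (k : nat) (H : 'I_k -> sgraph)
    (Y : {set {set big_disj_union H}}) : (0 < k)%N ->
  f (del_edges Y) = \prod_i f (del_edges (restr_edges Y i)).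
Proof.
move=> k_gt0; case: f_inv => _ f_iso.
by rewrite (f_iso _ _ (isomorphic_del_big_union Y)) multiplicative_big_union.
Qed.

(** The minimum runs over all components: an infinite value does not affect it, so the set of finite
    ones need not appear yet. *)
Lemma es_big_union (k : nat) (H : 'I_k -> sgraph) : (0 < k)%N ->
  f (big_disj_union H) != 0 ->
  es f (big_disj_union H) = (\big[Order.min/+oo]_i es f (H i))%E.
Proof.
move=> k_gt0 fG_neq0; have [_ f_iso] := f_inv.
apply/eqP; rewrite eq_le; apply/andP; split.
  (* Upper bound: a changing set [Z] of component [i] lifts to a changing set of the union of the
     same size. *)
  apply/bigmin_geP; split; first exact: leey.
  move=> i _; apply/bigmin_geP; split; first exact: leey.
  move=> Z; rewrite inE => /andP[ZH fZ].
  rewrite -card_lift_edges; apply: bigmin_le_cond.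
  rewrite inE lift_edges_sub //=; move: fG_neq0.
  rewrite multiplicative_del_big_union // multiplicative_big_union //.
  rewrite [\prod_i f (H i)](bigD1 i) //= [\prod_i f (del_edges _)](bigD1 i) //=.
  (* The factors other than [i] have a nonzero product, which can be cancelled once deleting the
     lift is seen to leave these factors unchanged. *)
  rewrite mulf_eq0 negb_or lift_edgesK => /andP[_ prod_neq0].
  rewrite [X in _ * X != _](_ : _ = \prod_(j | j != i) f (H j)).
    by rewrite (inj_eq (mulIf prod_neq0)).
  apply: eq_bigr => j ji; rewrite restr_lift_edges_neq //.
  exact/f_iso/isomorphic_del0.
(* Lower bound: a changing set [Y] of the union restricts to a changing set, no larger, of some
   component. *)
apply/bigmin_geP; split; first exact: leey.
move=> Y; rewrite inE => /andP[YG fY].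
have [i fYi] : exists i, f (del_edges (restr_edges Y i)) != f (H i).
  apply/existsP; apply: contraNT fY => /existsPn feq.
  rewrite multiplicative_del_big_union // multiplicative_big_union //.
  by apply/eqP/eq_bigr => i _; apply/eqP; rewrite -[_ == _]negbK feq.
apply: (@bigmin_inf _ _ _ _ i) => //.
apply: (@bigmin_inf _ _ _ _ (restr_edges Y i)).
  by rewrite inE restr_edges_sub.
by rewrite lee_fin ler_nat card_restr_edges.
Qed.
End Multiplicative.

Theorem theorem3p5 (R : realType) (f : sgraph -> R)
    (f_inv : graph_invariant f) (f_mul : multiplicative_invariant f)
    (k : nat) (k_ge1 : (1 <= k)%N) (H : 'I_k -> sgraph)
    (fG_neq0 : f (big_disj_union H) != 0) :
  let G := big_disj_union H in
  let I := [set i : 'I_k | (es f (H i) < +oo)%E] in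
  (I = set0 -> es f G = +oo%E) /\
  (I <> set0 -> es f G = (\big[Order.min/+oo]_(i in I) es f (H i))%E).
Proof.
move=> G I.
have esG : es f G = (\big[Order.min/+oo]_(i in I) es f (H i))%E.
  (* An index outside [I] has value [+oo], the default of the minimum, so restricting to [I] changes
     nothing; for empty [I] only this default remains. *)
  rewrite es_big_union // [RHS]big_mkcond /=; apply: eq_bigr => i _.
  by rewrite inE ltey; case: eqP.
by split=> // I0; rewrite esG I0 big_set0.
Qed.
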